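(* Let $G$ be a finite simple graph and let $\mathcal{S}_m$ be the star graph on $m+1$ vertices (with vertex set disjoint from that of $G$). Then $$H_{\mathbb{K}[G*\mathcal{S}_m]}(t)=H_{\mathbb{K}[G]}(t)+\frac{1}{(1-t)^m}+\frac{1}{1-t}-2.$$
   Context: $\mathbb{K}$ is a field. For a finite simple graph $G$ with vertex set $V(G)=\{x_1,\dots,x_n\}$, the edge ring is $\mathbb{K}[G]=\mathbb{K}[x_1,\dots,x_n]/I(G)$, where $I(G)$ is generated by the monomials $x_ix_j$ with $\{x_i,x_j\}\in E(G)$. $H_{\mathbb{K}[G]}(t)$ denotes its Hilbert series with respect to the standard grading. The star graph $\mathcal{S}_m$ has $m+1$ vertices: one vertex of degree $m$, adjacent to all the other $m$ vertices, which have degree $1$. For graphs $G,H$ with $V(G)\cap V(H)=\emptyset$, the product $G*H$ is the graph on $V(G)\cup V(H)$ with edge set $E(G)\cup E(H)\cup\{\{x,y\}\mid x\in V(G),\ y\in V(H)\}$. *)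

(* Defs.v *)
From HB Require Import structures.
From mathcomp Require Import all_boot all_order all_algebra.
From mathcomp Require Import ring_quotient.
From mathcomp Require Import boolp.
From mathcomp Require Import mpoly.
From Stdlib Require Import ClassicalEpsilon.

Set Implicit Arguments.
Unset Strict Implicit.
Unset Printing Implicit Defensive.

Import GRing.Theory.
Local Open Scope ring_scope.

(* A record rather than a bare function, so that multiplication is the Cauchy
   product and not the pointwise one. *)
Record fps (R : Type) := Fps { fcoef : nat -> R }.

HB.instance Definition _ (R : Type) := gen_eqMixin (fps R).
HB.instance Definition _ (R : Type) := gen_choiceMixin (fps R).

Lemma fpsP (R : Type) (f g : fps R) : fcoef f =1 fcoef g -> f = g.
Proof. by case: f g => [f] [g] /= /funext ->. Qed.

Section FpsRing.
Variable R : comNzRingType.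
Implicit Types f g h : fps R.

Definition fps0 : fps R := Fps (fun=> 0).
Definition fps1 : fps R := Fps (fun n => (n == 0%N)%:R).
Definition fpsX : fps R := Fps (fun n => (n == 1%N)%:R).
Definition fps_opp f : fps R := Fps (fun n => - fcoef f n).
Definition fps_add f g : fps R := Fps (fun n => fcoef f n + fcoef g n).
Definition fps_mul f g : fps R :=
  Fps (fun n => \sum_(i < n.+1) fcoef f i * fcoef g (n - i)).

Fact fps_addA : associative fps_add.
Proof. by move=> f g h; apply: fpsP => n /=; rewrite addrA. Qed.
Fact fps_addC : commutative fps_add.
Proof. by move=> f g; apply: fpsP => n /=; rewrite addrC. Qed.
Fact fps_add0 : left_id fps0 fps_add.
Proof. by move=> f; apply: fpsP => n /=; rewrite add0r. Qed.
Fact fps_addN : left_inverse fps0 fps_opp fps_add.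
Proof. by move=> f; apply: fpsP => n /=; rewrite addNr. Qed.

HB.instance Definition _ :=
  GRing.isZmodule.Build (fps R) fps_addA fps_addC fps_add0 fps_addN.

Definition fps_trunc N f : {poly R} := \poly_(i < N) fcoef f i.

Fact fps_trunc_mul N f g n : (n < N)%N ->
  (fps_trunc N f * fps_trunc N g)`_n = fcoef (fps_mul f g) n.
Proof.
move=> ltnN; rewrite coefM /=; apply: eq_bigr => i _; rewrite !coef_poly.
by rewrite (leq_trans (ltn_ord i)) // (leq_ltn_trans (leq_subr _ _)).
Qed.

Fact fps_mulC : commutative fps_mul.
Proof. by move=> f g; apply: fpsP => n; rewrite -!(@fps_trunc_mul n.+1) // mulrC. Qed.

Fact fps_mulA : associative fps_mul.
Proof.
have tr N p f g n : (n < N)%N ->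
    (p * fps_trunc N (fps_mul f g))`_n =
    (p * (fps_trunc N f * fps_trunc N g))`_n.
  move=> ltnN; rewrite !coefM; apply: eq_bigr => i _; congr (_ * _).
  have lt : (n - i < N)%N by rewrite (leq_ltn_trans (leq_subr _ _)).
  by rewrite fps_trunc_mul // coef_poly lt.
move=> f g h; apply: fpsP => n.
rewrite -!(@fps_trunc_mul n.+1) // tr // [in RHS]mulrC tr //.
by rewrite mulrA [in RHS]mulrC.
Qed.

Fact fps_mul1 : left_id fps1 fps_mul.
Proof.
move=> f; apply: fpsP => n /=; rewrite big_ord_recl /= mul1r subn0.
by rewrite big1 ?addr0 // => i _; rewrite mul0r.
Qed.

Fact fps_mulDl : left_distributive fps_mul fps_add.
Proof.
move=> f g h; apply: fpsP => n /=; rewrite -big_split /=.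
by apply: eq_bigr => i _; rewrite mulrDl.
Qed.

Fact fps1_neq0 : fps1 != 0.
Proof.
apply/eqP => /(congr1 (fun f => fcoef f 0)) /= /eqP.
by rewrite oner_eq0.
Qed.

HB.instance Definition _ := GRing.Zmodule_isComNzRing.Build (fps R)
  fps_mulA fps_mulC fps_mul1 fps_mulDl fps1_neq0.

End FpsRing.

Section FpsUnitRing.
Variable R : comUnitRingType.
Implicit Types f g : fps R.

Definition fps_unit : {pred fps R} := [pred f | fcoef f 0 \is a GRing.unit].

(* The first n coefficients of the inverse, obtained by solving f * g = 1
   degree by degree. *)
Fixpoint fps_inv_seq f n : seq R :=
  if n is k.+1 then
    let s := fps_inv_seq f k in
    rcons s ((fcoef f 0)^-1 *
             ((k == 0%N)%:R - \sum_(i < k) s`_i * fcoef f (k - i)))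
  else [::].

Definition fps_inv f : fps R :=
  if f \in fps_unit then Fps (fun n => (fps_inv_seq f n.+1)`_n) else f.

Fact size_fps_inv_seq f n : size (fps_inv_seq f n) = n.
Proof. by elim: n => //= n IH; rewrite size_rcons IH. Qed.

Fact nth_fps_inv_seq f n i : (i < n)%N ->
  (fps_inv_seq f n)`_i = (fps_inv_seq f i.+1)`_i.
Proof.
elim: n => // n IH; rewrite ltnS leq_eqVlt => /predU1P[-> //|lt].
by rewrite [in LHS]/= nth_rcons size_fps_inv_seq lt IH.
Qed.

Fact fps_mulVr : {in fps_unit, left_inverse 1 fps_inv *%R}.
Proof.
move=> f uf; apply: fpsP => n; rewrite /fps_inv uf.
transitivity (fcoef (fps_mul (Fps (fun k => (fps_inv_seq f k.+1)`_k)) f) n).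
  by [].
rewrite [LHS]/= big_ord_recr subnn /= nth_rcons size_fps_inv_seq.
rewrite ltnn eqxx mulrAC mulVr // mul1r.
rewrite (eq_bigr (fun i : 'I_n => (fps_inv_seq f n)`_i * fcoef f (n - i))).
  by rewrite [LHS]/= addrC addrNK.
by move=> i _; congr (_ * _); rewrite [RHS]nth_fps_inv_seq.
Qed.

Fact fps_unitP f g : g * f = 1 -> f \in fps_unit.
Proof.
move=> /(congr1 (fun f => fcoef f 0)) /=.
rewrite big_ord1 subn0 => e; apply/unitrP; exists (fcoef g 0).
by split=> //; rewrite mulrC.
Qed.

Fact fps_inv_out : {in [predC fps_unit], fps_inv =1 id}.
Proof. by move=> f /negPf nf; rewrite /fps_inv nf. Qed.

HB.instance Definition _ := GRing.ComNzRing_hasMulInverse.Build (fps R)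
  fps_mulVr fps_unitP fps_inv_out.

End FpsUnitRing.

Arguments fpsX {R}.

Record sgraph := SGraph {
  vert :> finType;
  adj : rel vert;
  adj_sym : ssrbool.symmetric adj;
  adj_irr : irreflexive adj }.

(* G * H; the sum of the vertex types makes the vertex sets disjoint. *)
Section GraphProd.
Variables G H : sgraph.

Definition gprod_adj (u v : G + H) : bool :=
  match u, v with
  | inl x, inl y => adj x y
  | inr x, inr y => adj x y
  | _, _ => true
  end.

Fact gprod_sym : ssrbool.symmetric gprod_adj.
Proof. by case=> x [] y //=; rewrite adj_sym. Qed.
Fact gprod_irr : irreflexive gprod_adj.
Proof. by case=> x /=; rewrite adj_irr. Qed.

Definition gprod : sgraph := SGraph gprod_sym gprod_irr.
End GraphProd.

(* The centre is ord0: an edge has exactly one endpoint equal to ord0. *)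
Section Star.
Variable m : nat.

Definition star_adj (u v : 'I_m.+1) : bool := (u == ord0) != (v == ord0).

Fact star_sym : ssrbool.symmetric star_adj.
Proof. by move=> u v; rewrite /star_adj eq_sym. Qed.
Fact star_irr : irreflexive star_adj.
Proof. by move=> u; rewrite /star_adj eqxx. Qed.

Definition star : sgraph := SGraph star_sym star_irr.
End Star.

Definition ideal_gen (R : comNzRingType) (S : R -> Prop) : {pred R} :=
  fun p => `[< exists2 s : seq (R * R),
                 (forall u, u \in s -> S u.2) & p = \sum_(u <- s) u.1 * u.2 >].

Section EdgeRing.
Variables (K : fieldType) (G : sgraph).

Local Notation A := {mpoly K[#|G|]}.

Definition edge_monomial (p : A) : Prop :=
  exists x y : G, adj x y /\ p = 'X_(enum_rank x) * 'X_(enum_rank y).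

Definition edge_ideal : {pred A} := ideal_gen edge_monomial.

Fact edge_ideal_closed : idealr_closed edge_ideal.
Proof.
split.
- by apply/asboolP; exists [::]; rewrite ?big_nil.
- apply/asboolPn => -[s hs /(congr1 (meval (fun=> 0)))].
  rewrite rmorph1 raddf_sum big_seq big1 => [/eqP|u /hs[x [y [_ ->]]]].
    by rewrite oner_eq0.
  by rewrite [LHS]/= !mevalM !mevalXU !mulr0.
- move=> a p q /asboolP[s hs ->] /asboolP[s' hs' ->]; apply/asboolP.
  exists ([seq (a * u.1, u.2) | u <- s] ++ s').
    by move=> u; rewrite mem_cat => /orP[/mapP[v /hs ? ->]|/hs'].
  rewrite big_cat big_map mulr_sumr /=; congr (_ + _).
  by apply: eq_bigr => u _; rewrite mulrA.
Qed.

HB.instance Definition _ := isIdealr.Build A edge_ideal edge_ideal_closed.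

Definition edge_ring : Type := {ideal_quot edge_ideal}.

HB.instance Definition _ := GRing.ComNzRing.on edge_ring.

Definition edge_proj (p : A) : edge_ring := \pi_({ideal_quot edge_ideal})%qT p.

Definition edge_scale (c : K) (u : edge_ring) : edge_ring :=
  edge_proj c%:MP * u.

Fact edge_projD : {morph edge_proj : p q / p + q}.
Proof. by move=> p q; rewrite /edge_proj rmorphD. Qed.
Fact edge_projM : {morph edge_proj : p q / p * q}.
Proof. by move=> p q; rewrite /edge_proj rmorphM. Qed.
Fact edge_proj1 : edge_proj 1 = 1.
Proof. by rewrite /edge_proj rmorph1. Qed.

Fact edge_scaleA a b v : edge_scale a (edge_scale b v) = edge_scale (a * b) v.
Proof. by rewrite /edge_scale mulrA -edge_projM -mpolyCM. Qed.
Fact edge_scale1 : left_id 1 edge_scale.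
Proof. by move=> v; rewrite /edge_scale edge_proj1 mul1r. Qed.
Fact edge_scaleDr : right_distributive edge_scale +%R.
Proof. by move=> c u v; rewrite /edge_scale mulrDr. Qed.
Fact edge_scaleDl v : {morph edge_scale^~ v : a b / a + b}.
Proof. by move=> a b; rewrite /edge_scale mpolyCD edge_projD mulrDl. Qed.

HB.instance Definition _ := GRing.Zmodule_isLmodule.Build K edge_ring
  edge_scaleA edge_scale1 edge_scaleDr edge_scaleDl.

Definition edge_ring_graded (d : nat) (u : edge_ring) : Prop :=
  exists2 p : A, p \is d.-homog & u = edge_proj p.

End EdgeRing.

Section Dimension.
Variables (K : fieldType) (V : lmodType K) (W : V -> Prop).

Definition is_basis (k : nat) (b : 'I_k -> V) : Prop :=
  [/\ forall i, W (b i),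
      forall c : 'I_k -> K, \sum_(i < k) c i *: b i = 0 -> forall i, c i = 0
    & forall v, W v -> exists c : 'I_k -> K, v = \sum_(i < k) c i *: b i].

(* The dimension of W when W is a finite-dimensional subspace of V (see vdimE);
   an unspecified number otherwise. *)
Definition vdim : nat :=
  epsilon (inhabits 0%N) (fun k => exists b : 'I_k -> V, is_basis b).

Fact is_basis_le k l (b : 'I_k -> V) (b' : 'I_l -> V) :
  is_basis b -> is_basis b' -> (k <= l)%N.
Proof.
case=> Wb fb gb [Wb' _ gb'].
have /fin_all_exists[C bE] i := gb' _ (Wb i).
have /fin_all_exists[D b'E] j := gb _ (Wb' j).
apply: (@mulmx1_min _ k l (\matrix_(i, j) C i j) (\matrix_(j, i) D j i)).
apply/matrixP => i i'; rewrite !mxE; apply/eqP; rewrite -subr_eq0; apply/eqP.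
pose c i' := \sum_j C i j * D j i' - (i == i')%:R.
under eq_bigr => j _ do rewrite !mxE.
apply: (fb c); under eq_bigr => h _ do rewrite scalerBl scaler_suml.
rewrite sumrB exchange_big /= [X in _ - X](bigD1 i) //= eqxx scale1r.
rewrite [X in _ - (_ + X)]big1 ?addr0 => [|h /negPf ne]; last first.
  by rewrite eq_sym ne scale0r.
apply/eqP; rewrite subr_eq0 [X in _ == X]bE; apply/eqP; apply: eq_bigr => j _.
by rewrite b'E scaler_sumr; apply: eq_bigr => h _; rewrite scalerA.
Qed.

Fact vdimE k (b : 'I_k -> V) : is_basis b -> vdim = k.
Proof.
move=> hb; have [|b' hb'] := @epsilon_spec nat (inhabits 0%N)
  (fun k => exists b : 'I_k -> V, is_basis b); first by exists k, b.
by apply/eqP; rewrite eqn_leq (is_basis_le hb' hb) (is_basis_le hb hb').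
Qed.

End Dimension.

Definition hilbert_series (K : fieldType) (G : sgraph) : fps int :=
  Fps (fun d => Posz (vdim (@edge_ring_graded K G d))).

(* Main.v *)
Require Import Defs.
From mathcomp Require Import all_boot all_order all_algebra.
From mathcomp Require Import boolp mpoly.

(** The edge ideal is a monomial ideal, so the monomials outside it descend to a
basis of the edge ring.  A monomial lies outside it exactly when its support
contains no edge; call such a monomial standard.  The Hilbert function of
K[G] in degree d is therefore the number of standard monomials of degree d
([hilbert_seriesE]), and the field disappears from the problem.

In a join of G and H, a standard monomial cannot involve a vertex of G and a
vertex of H at once, because these are adjacent.  So the standard monomials of
the join are those of G together with those of H, and the two families share
only the monomial 1.  Hence the Hilbert series of a join is the sum of the two
series minus 1 ([hilbert_series_join]).

The star is itself a join, of its centre with an edgeless graph on its m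
leaves.  The edge ring of an edgeless graph on m vertices is a polynomial ring,
whose series is (1 - t)^(-m) ([hilbert_series_discrete]).  Applying the join
formula twice yields the claim, each application contributing one -1.

A join is described by a pair of embeddings ([is_join]) and not as [gprod]
itself: the star is carried by an ordinal type and is only isomorphic to a
[gprod], and this description covers both without a transport along
isomorphisms. *)

Set Implicit Arguments.
Unset Strict Implicit.
Unset Printing Implicit Defensive.

Import GRing.Theory.

Local Open Scope ring_scope.

(** * Standard monomials form a basis of the edge ring *)

Section StandardMonomials.
Variables (K : fieldType) (G : sgraph).
Local Notation n := #|G|.

Definition standard_mnm (m : 'X_{1..n}) :=
  [forall x : G, forall y : G,
     adj x y ==> ((m (enum_rank x) == 0) || (m (enum_rank y) == 0))%N].

Lemma standard_mnmPn (m : 'X_{1..n}) :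
  reflect (exists x y : G, [/\ adj x y, m (enum_rank x) != 0%N
                             & m (enum_rank y) != 0%N])
          (~~ standard_mnm m).
Proof.
apply: (iffP idP) => [/forallPn[x /forallPn[y]]|[x [y [xy mx my]]]].
  by rewrite negb_imply negb_or => /and3P[*]; exists x, y; split.
apply/forallPn; exists x; apply/forallPn; exists y.
by rewrite negb_imply negb_or xy mx my.
Qed.

(** Each generator times a monomial has an edge in its support, and the
monomials of an element of the ideal are among the monomials of such
products. *)
Lemma edge_ideal_mcoeff (p : {mpoly K[n]}) m :
  p \in @edge_ideal K G -> standard_mnm m -> p@_m = 0.
Proof.
move=> /asboolP[s hs ->] std_m.
rewrite linear_sum big_seq big1 //= => -[q e] /hs[x [y [xy /= ->]]] /=.
rewrite -mpolyXD mcoeffM big1 // => k /eqP mE.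
rewrite mcoeffX; case: eqP => [kE|_]; last by rewrite mulr0.
suff: ~~ standard_mnm m by rewrite std_m.
apply/standard_mnmPn; exists x, y; split=> //;
  by rewrite mE -kE !mnmDE !mnm1E !eqxx !(addn1, add1n, addnS).
Qed.

(** The support of [m] contains an edge, and the corresponding generator divides
['X_[m]]; the endpoints being distinct, the exponents bound their product. *)
Lemma mpolyX_edge_ideal m : ~~ standard_mnm m -> 'X_[m] \in @edge_ideal K G.
Proof.
move=> /standard_mnmPn[x [y [xy mx my]]].
have le_xy : (U_(enum_rank x) + U_(enum_rank y) <= m)%MM.
  apply/mnm_lepP => i; rewrite mnmDE !mnm1E.
  case: eqVneq => [<-|_]; last by case: eqVneq => // <-; rewrite lt0n.
  have [/enum_rank_inj yx|_] := eqVneq; last by rewrite lt0n.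
  by rewrite yx adj_irr in xy.
apply/asboolP; exists [:: ('X_[m - (U_(enum_rank x) + U_(enum_rank y))],
                           'X_(enum_rank x) * 'X_(enum_rank y))].
  by move=> u /[!inE] /eqP ->; exists x, y.
by rewrite big_seq1 /= -!mpolyXD submK.
Qed.

Lemma edge_proj_eq0 (p : {mpoly K[n]}) :
  (edge_proj p == 0) = (p \in @edge_ideal K G).
Proof.
have -> : 0 = edge_proj 0 :> edge_ring K G by rewrite /edge_proj raddf0.
by rewrite /edge_proj -Quotient.idealrBE subr0.
Qed.

Lemma edge_projZ c (p : {mpoly K[n]}) :
  edge_proj (c *: p) = c *: (edge_proj p : edge_ring K G).
Proof. by rewrite -mul_mpolyC edge_projM. Qed.

Lemma edge_proj_sum I (r : seq I) P (F : I -> {mpoly K[n]}) :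
  edge_proj (\sum_(i <- r | P i) F i)
    = \sum_(i <- r | P i) (edge_proj (F i) : edge_ring K G).
Proof. by rewrite /edge_proj raddf_sum. Qed.

(** In degree [d] every exponent is at most [d], so exponent vectors can be taken
in a finite type, indexed by the vertices and not by their ranks. *)
Definition ffun_mnm d (f : {ffun G -> 'I_d.+1}) : 'X_{1..n} :=
  [multinom (f (enum_val i) : nat) | i < n].

Definition standard_ffun d : {set {ffun G -> 'I_d.+1}} :=
  [set f : {ffun G -> 'I_d.+1} | (\sum_x f x == d)%N &&
     [forall x, forall y, adj x y ==> ((f x == ord0) || (f y == ord0))]].

Lemma ffun_mnm_rank d (f : {ffun G -> 'I_d.+1}) x :
  ffun_mnm f (enum_rank x) = f x.
Proof. by rewrite mnmE enum_rankK. Qed.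

Lemma ffun_mnm_inj d : injective (@ffun_mnm d).
Proof.
move=> f g /mnmP fg; apply/ffunP => x; apply/val_inj.
by rewrite /= -!ffun_mnm_rank fg.
Qed.

Lemma mdeg_ffun_mnm d (f : {ffun G -> 'I_d.+1}) :
  mdeg (ffun_mnm f) = (\sum_x f x)%N.
Proof.
rewrite mdegE (reindex enum_rank) /=; last exact/onW_bij/enum_rank_bij.
by apply: eq_bigr => x _; rewrite ffun_mnm_rank.
Qed.

Lemma ffun_mnm_surj (m : 'X_{1..n}) :
  exists f : {ffun G -> 'I_(mdeg m).+1}, m = ffun_mnm f.
Proof.
exists [ffun x => inord (m (enum_rank x))]; apply/mnmP => i.
by rewrite mnmE ffunE enum_valK inordK // ltnS mdegE (bigD1 i) //= leq_addr.
Qed.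

Lemma standard_ffunE d f :
  (f \in standard_ffun d) = (mdeg (ffun_mnm f) == d) && standard_mnm (ffun_mnm f).
Proof.
rewrite inE mdeg_ffun_mnm; congr (_ && _).
apply: eq_forallb => x; apply: eq_forallb => y.
by rewrite !ffun_mnm_rank.
Qed.

Definition standard_basis d (i : 'I_#|standard_ffun d|) : edge_ring K G :=
  edge_proj 'X_[ffun_mnm (enum_val i)].

(** Independence: a vanishing combination lifts to an element of the ideal, which
has no standard coefficient.  Generation: subtracting from a homogeneous
polynomial its standard part leaves only monomials of the ideal. *)
Lemma standard_basisP d :
  is_basis (@edge_ring_graded K G d) (@standard_basis d).
Proof.
split=> [i|c c0 i|_ [p /dhomogP p_hom ->]].
- exists 'X_[ffun_mnm (enum_val i)] => //; rewrite dhomogX.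
  by have := enum_valP i; rewrite standard_ffunE => /andP[].
- have /eqP : edge_proj (\sum_i c i *: 'X_[ffun_mnm (enum_val i)])
      = 0 :> edge_ring K G.
    rewrite edge_proj_sum -[RHS]c0; apply: eq_bigr => j _.
    by rewrite edge_projZ.
  rewrite edge_proj_eq0 => /edge_ideal_mcoeff coef0.
  have := enum_valP i; rewrite standard_ffunE => /andP[_ /coef0].
  rewrite linear_sum (bigD1 i) //= big1 ?addr0 => [|j ne_ji].
    by rewrite mcoeffZ mcoeffX eqxx mulr1.
  rewrite mcoeffZ mcoeffX (inj_eq (@ffun_mnm_inj d)) (inj_eq enum_val_inj).
  by rewrite (negPf ne_ji) mulr0.
- exists (fun i => p@_(ffun_mnm (enum_val i))); apply/eqP.
  under eq_bigr do rewrite -edge_projZ.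
  rewrite -edge_proj_sum -subr_eq0 /edge_proj -rmorphB edge_proj_eq0.
  set q := p - _.
  have q_std m : standard_mnm m -> q@_m = 0.
    move=> std_m; rewrite mcoeffB linear_sum /=.
    (* Outside degree d, neither p nor the subtracted sum has a coefficient. *)
    have [dE|ne_d] := eqVneq (mdeg m) d; last first.
      rewrite memN_msupp_eq0 ?sub0r ?big1 ?oppr0 // => [i _|].
        rewrite mcoeffZ mcoeffX; case: eqP => [mE|_]; last by rewrite mulr0.
        have := enum_valP i; rewrite standard_ffunE mE.
        by rewrite (negPf ne_d).
      by apply: contra ne_d => /p_hom /eqP.
    subst d; have [f mE] := ffun_mnm_surj m.
    have f_std : f \in standard_ffun (mdeg m).
      by rewrite standard_ffunE -mE eqxx.
    rewrite (bigD1 (enum_rank_in f_std f)) //= big1 => [|i ne_if].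
      rewrite enum_rankK_in // mcoeffZ mcoeffX -mE eqxx mulr1 addr0.
      by rewrite subrr.
    rewrite mcoeffZ mcoeffX; case: eqP => [imE|_]; last by rewrite mulr0.
    case/eqP: ne_if; apply: enum_val_inj; rewrite enum_rankK_in //.
    by apply: ffun_mnm_inj; rewrite imE.
  rewrite [q]mpolyE; apply: rpred_sum => m _.
  have [/q_std ->|/mpolyX_edge_ideal Xm] := boolP (standard_mnm m).
    by rewrite scale0r rpred0.
  by rewrite -mul_mpolyC idealMr.
Qed.

Lemma hilbert_seriesE d :
  fcoef (hilbert_series K G) d = Posz #|standard_ffun d|.
Proof. by congr Posz; apply: vdimE (@standard_basisP d). Qed.

End StandardMonomials.

(** * Standard monomials of a join *)

Section InducedSubgraph.
Variables (G J : sgraph) (i : G -> J).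
Hypotheses (i_inj : injective i) (i_adj : forall x y, adj (i x) (i y) = adj x y).

Definition supported_ffun d : {set {ffun J -> 'I_d.+1}} :=
  [set f in standard_ffun J d | [forall v, (v \notin codom i) ==> (f v == ord0)]].

Lemma sum_supported (F : J -> nat) :
  (forall v, v \notin codom i -> F v = 0%N) -> (\sum_v F v = \sum_x F (i x))%N.
Proof.
move=> F0; rewrite (bigID (fun v => v \in codom i)) /= [X in (_ + X)%N]big1 // addn0.
rewrite -(big_imset F (in2W i_inj)); apply: eq_bigl => v.
by apply/codomP/imsetP => [[x ->]|[x _ ->]]; exists x.
Qed.

Lemma standard_restrict d (f : {ffun J -> 'I_d.+1}) :
  (forall v, v \notin codom i -> f v = ord0) ->
  (f \in standard_ffun J d) = ([ffun x => f (i x)] \in standard_ffun G d).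
Proof.
move=> f0; rewrite !inE; congr (_ && _).
  by rewrite sum_supported => [|v /f0 -> //]; under [in RHS]eq_bigr do rewrite ffunE.
apply/forallP/forallP => f_std x; apply/forallP => y; apply/implyP => xy.
  rewrite !ffunE; move: (f_std (i x)) => /forallP/(_ (i y)).
  by rewrite i_adj xy.
have [/codomP[x' xE]|/f0 ->] := boolP (x \in codom i); last by rewrite eqxx.
have [/codomP[y' yE]|/f0 ->] := boolP (y \in codom i); last by rewrite eqxx orbT.
move: (f_std x') => /forallP/(_ y'); rewrite !ffunE -i_adj -xE -yE xy.
exact.
Qed.

(** Restriction along [i] is a bijection, with extension by zero as inverse: since
[i] is an induced embedding, the edges that could meet the support of a
function vanishing off [codom i] are those of [G]. *)
Lemma card_supported d : #|supported_ffun d| = #|standard_ffun G d|.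
Proof.
pose restr (f : {ffun J -> 'I_d.+1}) : {ffun G -> 'I_d.+1} := [ffun x : G => f (i x)].
have supp0 f v : f \in supported_ffun d -> v \notin codom i -> f v = ord0.
  by rewrite inE => /andP[_ /forallP/(_ v)/implyP f0] /f0 /eqP.
rewrite -(@card_in_imset _ _ restr) => [|f g f_s g_s /ffunP fg]; last first.
  apply/ffunP => v; have [/codomP[x ->]|vN] := boolP (v \in codom i).
    by have := fg x; rewrite !ffunE.
  by rewrite !supp0.
apply: eq_card => g; apply/imsetP/idP => [[f f_s ->]|g_std].
  rewrite -standard_restrict => [|v]; last exact: supp0.
  by move: f_s; rewrite inE => /andP[].
pose f : {ffun J -> 'I_d.+1} := [ffun v : J => if [pick x | i x == v] is Some x then g x else ord0].
have f0 v : v \notin codom i -> f v = ord0.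
  rewrite ffunE; case: pickP => // x /eqP <-; by rewrite codom_f.
have fg : g = restr f.
  apply/ffunP => x; rewrite !ffunE; case: pickP => [y /eqP/i_inj -> //|].
  by move/(_ x); rewrite eqxx.
exists f => //; rewrite inE standard_restrict // -[finfun _]/(restr f) -fg g_std.
by apply/forallP => v; apply/implyP => /f0 ->.
Qed.

End InducedSubgraph.

(** The images of [i] and [j] are disjoint because adjacency is irreflexive. *)
Record is_join (J G H : sgraph) (i : G -> J) (j : H -> J) : Prop := IsJoin {
  join_injl : injective i;
  join_injr : injective j;
  join_adjl : forall x y, adj (i x) (i y) = adj x y;
  join_adjr : forall x y, adj (j x) (j y) = adj x y;
  join_adj : forall x y, adj (i x) (j y);
  join_cover : forall v, (v \in codom i) || (v \in codom j) }.

Section Join.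
Variables (J G H : sgraph) (i : G -> J) (j : H -> J).
Hypothesis J_join : is_join i j.

Lemma join_disjoint v : v \in codom i -> v \in codom j -> False.
Proof.
case/codomP=> x -> /codomP[y xy].
by have := join_adj J_join x y; rewrite -xy adj_irr.
Qed.

(** If [f] does not vanish at some [i x], it must vanish on all of [codom j],
since [i x] is adjacent to every vertex there. *)
Lemma supported_joinU d :
  standard_ffun J d = supported_ffun i d :|: supported_ffun j d.
Proof.
apply/setP => f; rewrite !inE -andb_orr.
apply/idP/andP => [/andP[-> f_std]|[]//].
split=> //; apply/orP; move/forallP in f_std.
have [f0|] := boolP [forall x, f (i x) == ord0].
  right; apply/forallP => v; apply/implyP => vN.
  have := join_cover J_join v; rewrite (negPf vN) orbF => /codomP[x ->].
  exact: (forallP f0).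
case/forallPn => x fx; left; apply/forallP => v; apply/implyP => vN.
have := join_cover J_join v; rewrite (negPf vN) /= => /codomP[y ->].
move: (f_std (i x)) => /forallP/(_ (j y)).
by rewrite (join_adj J_join) (negPf fx).
Qed.

(** A function vanishing off both parts is zero, so it has degree 0: the two
families of standard monomials share only 1. *)
Lemma supported_joinI d :
  supported_ffun i d :&: supported_ffun j d =
    if d == 0%N then [set [ffun=> ord0]] else set0.
Proof.
apply/setP => f; transitivity ((d == 0%N) && (f == [ffun=> ord0])); last first.
  by case: (d == 0%N); rewrite !inE.
apply/idP/andP => [|[/eqP d0 /eqP fE]].
  rewrite inE => /andP[]; rewrite 2!inE => /andP[/andP[/eqP dE _] fi].
  rewrite inE => /andP[_ fj].
  have f0 : f = [ffun=> ord0].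
    apply/ffunP => v; rewrite ffunE; apply/eqP.
    have [/join_disjoint vj|vN] := boolP (v \in codom i).
      by move: (forallP fj v) => /implyP; apply; apply/negP.
    by move: (forallP fi v) => /implyP; apply.
  by split; [rewrite -dE f0 big1 // => v _; rewrite ffunE | apply/eqP].
suff f_std : f \in standard_ffun J d.
  by apply/setIP; split; apply/setIdP; split=> //; apply/forallP => v;
    rewrite fE ffunE eqxx implybT.
rewrite inE fE big1 ?d0 => [|v _]; last by rewrite ffunE.
by apply/forallP => u; apply/forallP => v; rewrite ffunE eqxx implybT.
Qed.

Lemma card_standard_join d :
  (#|standard_ffun J d| + (d == 0) =
     #|standard_ffun G d| + #|standard_ffun H d|)%N.
Proof.
rewrite -(card_supported (join_injl J_join) (join_adjl J_join)).
rewrite -(card_supported (join_injr J_join) (join_adjr J_join)).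
rewrite -cardsUI -supported_joinU supported_joinI.
by case: (d == 0%N); rewrite ?cards1 ?cards0.
Qed.

(** The constant -1 compensates for the monomial 1, counted once in each part. *)
Lemma hilbert_series_join (K : fieldType) :
  hilbert_series K J = hilbert_series K G + hilbert_series K H - 1.
Proof.
apply: fpsP => d; rewrite hilbert_seriesE.
transitivity (fcoef (hilbert_series K G) d + fcoef (hilbert_series K H) d
              - (d == 0%N)%:R); last by [].
rewrite !hilbert_seriesE -PoszD -card_standard_join PoszD.
by case: (d == 0%N); rewrite addrK.
Qed.

End Join.

Lemma gprod_join (G H : sgraph) : @is_join (gprod G H) G H inl inr.
Proof.
split=> //; [exact: inl_inj | exact: inr_inj |].
by case=> x; rewrite codom_f ?orbT.
Qed.

(** * Edgeless graphs and the star *)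

Definition discrete m : sgraph :=
  @SGraph 'I_m (fun _ _ => false) (fun _ _ => erefl) (fun=> erefl).

Lemma star_join m :
  @is_join (star m) (discrete 1) (discrete m) (fun=> ord0) (lift ord0).
Proof.
split=> [x y _||||//|v].
- by rewrite !ord1.
- exact: lift_inj.
- by move=> x y; rewrite /= /star_adj eqxx.
- by [].
- have [j ->|->] := unliftP ord0 v; first by rewrite codom_f orbT.
  by rewrite (codom_f (fun=> ord0) (ord0 : 'I_1)).
Qed.

Lemma card_standard_discrete0 d : #|standard_ffun (discrete 0) d| = (d == 0%N).
Proof.
transitivity #|[set f : {ffun 'I_0 -> 'I_d.+1} | d == 0%N]|.
  apply: eq_card => f; rewrite !inE big_ord0 eq_sym.
  by rewrite [X in _ && X](_ : _ = true) ?andbT //; apply/forallP => -[].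
case: (d == 0%N); last by rewrite -[RHS](cards0 {ffun 'I_0 -> 'I_d.+1}).
by rewrite cardsT card_ffun !card_ord expn0.
Qed.

(** Without edges every monomial is standard, so this counts the ways of writing
[d] as an ordered sum of [m.+1] natural numbers. *)
Lemma card_standard_discreteS m d :
  #|standard_ffun (discrete m.+1) d| = 'C(m + d, m).
Proof.
rewrite -card_ord_partitions.
pose tup (f : {ffun 'I_m.+1 -> 'I_d.+1}) := [tuple f i | i < m.+1].
have tupK : cancel tup (fun t => [ffun i => tnth t i]).
  by move=> f; apply/ffunP => i; rewrite ffunE tnth_mktuple.
rewrite -(card_imset _ (can_inj tupK)); apply: eq_card => t.
apply/imsetP/idP => [[f]|]; rewrite !inE.
  move=> /andP[fd _] ->; rewrite big_tuple.
  by under eq_bigr do rewrite tnth_mktuple.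
move=> td; exists [ffun i => tnth t i].
  rewrite inE; apply/andP; split.
    rewrite big_tuple in td; rewrite (eq_bigr (fun i => tnth t i : nat)) //.
    by move=> i _; rewrite ffunE.
  by apply/forallP => x; apply/forallP.
by apply: eq_from_tnth => i; rewrite tnth_mktuple ffunE.
Qed.

Lemma fcoef_mul_1subX (R : comNzRingType) (f : fps R) d :
  fcoef (f * (1 - fpsX)) d = fcoef f d - (if d is e.+1 then fcoef f e else 0).
Proof.
rewrite mulrBr mulr1.
transitivity (fcoef f d - \sum_(i < d.+1) fcoef f i * (d - i == 1)%N%:R) => //.
congr (_ - _); case: d => [|e]; first by rewrite big_ord1 mulr0.
rewrite !big_ord_recr /= subSnn subnn mulr1 mulr0 addr0 big1 ?add0r // => i _.
by rewrite subSn 1?ltnW // eqSS subn_eq0 leqNgt ltn_ord mulr0.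
Qed.

Lemma unit_1subX m : (1 - fpsX : fps int) ^+ m \is a GRing.unit.
Proof. by apply: unitrX. Qed.

(** Multiplication by 1 - t takes differences of consecutive coefficients, and on
the binomial coefficients counting monomials this is Pascal's rule. *)
Lemma hilbert_series_discreteS (K : fieldType) m :
  hilbert_series K (discrete m.+1) * (1 - fpsX) = hilbert_series K (discrete m).
Proof.
apply: fpsP => d; rewrite fcoef_mul_1subX.
rewrite !hilbert_seriesE card_standard_discreteS.
case: m d => [|m] [|d]; rewrite ?hilbert_seriesE.
- by rewrite card_standard_discrete0.
- by rewrite card_standard_discrete0 card_standard_discreteS !bin0.
- by rewrite card_standard_discreteS !addn0 !binn subr0.
- by rewrite !card_standard_discreteS addnS binS PoszD addSnnS addrC addKr.
Qed.

Lemma hilbert_series_discrete (K : fieldType) m :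
  hilbert_series K (discrete m) = 1 / (1 - fpsX) ^+ m.
Proof.
apply: (mulIr (unit_1subX m)); rewrite divrK ?unit_1subX //.
elim: m => [|m IHm]; last by rewrite exprS mulrA hilbert_series_discreteS.
rewrite mulr1; apply: fpsP => d.
by rewrite hilbert_seriesE card_standard_discrete0 /=; case: (d == 0%N).
Qed.

Theorem corollary1p8 (K : fieldType) (G : sgraph) (m : nat) :
  hilbert_series K (gprod G (star m)) =
    hilbert_series K G + 1 / (1 - fpsX) ^+ m + 1 / (1 - fpsX) - 2.
Proof.
rewrite (hilbert_series_join (gprod_join G (star m))).
rewrite (hilbert_series_join (star_join m)) !hilbert_series_discrete expr1.
(* The join formula lists the centre of the star before its leaves. *)
rewrite [X in _ + (X - _)]addrC -!addrA; do 3! congr (_ + _).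
by rewrite -opprD.
Qed.
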